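(* Let $E$ be the vector lattice (with pointwise operations and pointwise order) of all continuous piecewise linear functions $[0,1]\to\mathbb{R}$ (with finitely many linear pieces), and let $u\in E$ be given by $u(t)=t$ for all $t\in[0,1]$. Then $E^{ru}=C[0,1]$, so that $(E^{ru})_u$ is the principal ideal of $C[0,1]$ generated by $u$, and $$(E_u)^{ru}=\Bigl\{f\in C[0,1] : \text{there exist sequences } (\varphi_n)\subseteq E_u \text{ and } (\varepsilon_n)\subseteq(0,\infty) \text{ with } \varepsilon_n\to 0 \text{ and } |\varphi_n-f|\le \varepsilon_n u \text{ for all } n\Bigr\}.$$ Furthermore, the inclusion $(E_u)^{ru}\subseteq (E^{ru})_u$ is strict, i.e. $(E_u)^{ru}\subsetneq (E^{ru})_u$.
   Context: Let $L$ be an Archimedean vector lattice. A sequence $(x_n)$ in $L$ is relatively uniformly convergent to $x\in L$ if there exist $w\in L^+$ (a regulator) and a real sequence $(\varepsilon_n)$ converging to $0$ such that $|x_n-x|\le\varepsilon_n w$ for all $n$. It is relatively uniformly Cauchy if there exist $w\in L^+$ and a real sequence $(\varepsilon_n)$ converging to $0$ such that $|x_n-x_m|\le\varepsilon_n w$ for all $m\ge n$. $L$ is relatively uniformly complete (uniformly complete) if every relatively uniformly Cauchy sequence in $L$ is relatively uniformly convergent in $L$. $L^\delta$ denotes the Dedekind completion of $L$. The relatively uniform completion $L^{ru}$ of $L$ is the intersection of all uniformly complete vector sublattices of $L^\delta$ that contain $L$. For $x\in L$, $L_x=\{y\in L : |y|\le\lambda |x| \text{ for some real } \lambda\ge 0\}$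 denotes the principal (order) ideal of $L$ generated by $x$, regarded as a vector lattice in its own right. $(L_x)^{ru}$ is the relatively uniform completion of the vector lattice $L_x$, while $(L^{ru})_x$ is the principal ideal generated by $x$ in $L^{ru}$. The Dedekind completion $(L_x)^\delta$ is naturally identified with the ideal $(L^\delta)_x$ of $L^\delta$, and under this identification $(L_x)^{ru}\subseteq (L^{ru})_x$ always holds. For the lattice $E$ of the claim, $C[0,1]$ (all continuous real functions on $[0,1]$) is regarded as a vector sublattice of $E^\delta$ containing $E$, via the canonical identification $E^\delta=C[0,1]^\delta$ (as $E$ is order dense and majorizing in $C[0,1]$). All equalities and inclusions in the claim are understood inside $E^\delta$. *)

(* Defs.v *)
From HB Require Import structures.
From mathcomp Require Import all_boot all_order all_algebra.
From mathcomp Require Import all_classical all_reals all_analysis.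
Set Implicit Arguments.
Unset Strict Implicit.
Unset Printing Implicit Defensive.
Import Order.TTheory GRing.Theory Num.Theory.
Import numFieldNormedType.Exports.
Local Open Scope classical_set_scope.
Local Open Scope ring_scope.

(* Real vector lattices. The binary suprema and infima are carried by the mixin
   because the library's hierarchy has no room for a structure that joins
   Order.Lattice with GRing.Zmodule below Num.RealDomain. *)
HB.mixin Record POrderedLmodule_isVectorLattice (R : realType) V
    of GRing.Lmodule R V & Order.POrder ring_display V := {
  lev_addr : forall z x y : V, x <= y -> x + z <= y + z;
  scalev_ge0 : forall (a : R) (x : V), 0 <= a -> 0 <= x -> 0 <= a *: x;
  vjoin : V -> V -> V;
  vmeet : V -> V -> V;
  leUv : forall x y z : V, (vjoin x y <= z) = (x <= z) && (y <= z);
  levI : forall x y z : V, (z <= vmeet x y) = (z <= x) && (z <= y)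
}.

#[short(type="vectorLatticeType")]
HB.structure Definition VectorLattice (R : realType) :=
  { V of GRing.Lmodule R V & Order.POrder ring_display V &
         POrderedLmodule_isVectorLattice R V }.

Section vector_lattices.
Context {R : realType} {V : vectorLatticeType R}.
Implicit Types (L M N A : set V) (x y z w b s : V).

Definition vabs x : V := vjoin x (- x).

Definition vector_sublattice L : Prop :=
  [/\ L 0,
      forall (a : R) x y, L x -> L y -> L (a *: x + y),
      forall x y, L x -> L y -> L (vjoin x y)
    & forall x y, L x -> L y -> L (vmeet x y)].

Definition principal_ideal L x : set V :=
  [set y | L y /\ exists2 a : R, 0 <= a & vabs y <= a *: vabs x].

(* In the next three definitions L is a vector lattice in its own right: the
   regulators and the limits are taken in L, not in the ambient lattice. *)
Definition ru_cvg L (x_ : nat -> V) x : Prop :=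
  exists w (eps : nat -> R),
    [/\ L w, 0 <= w, eps @ \oo --> (0 : R)
      & forall n, vabs (x_ n - x) <= eps n *: w].

Definition ru_cauchy L (x_ : nat -> V) : Prop :=
  exists w (eps : nat -> R),
    [/\ L w, 0 <= w, eps @ \oo --> (0 : R)
      & forall n m, (n <= m)%N -> vabs (x_ n - x_ m) <= eps n *: w].

Definition ru_complete L : Prop :=
  forall x_ : nat -> V, (forall n, L (x_ n)) -> ru_cauchy L x_ ->
    exists2 x, L x & ru_cvg L x_ x.

Definition dedekind_complete L : Prop :=
  forall A, A `<=` L -> A !=set0 ->
    (exists2 b, L b & forall x, A x -> x <= b) ->
    exists2 s, L s & (forall x, A x -> x <= s) /\
      (forall b, L b -> (forall x, A x -> x <= b) -> s <= b).

Definition order_dense L N : Prop :=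
  forall y, N y -> 0 < y -> exists2 x, L x & 0 < x <= y.

Definition majorizing L N : Prop :=
  forall y, N y -> exists2 x, L x & y <= x.

(* The vector sublattice N is a Dedekind completion of its vector sublattice L;
   as such it is unique up to a unique lattice isomorphism fixing L. *)
Definition dedekind_completion L N : Prop :=
  [/\ L `<=` N, dedekind_complete N, order_dense L N & majorizing L N].

(* The relatively uniform completion of L, where N is the Dedekind completion
   of L. *)
Definition ru_completion L N : set V :=
  \bigcap_(M in [set M | [/\ vector_sublattice M, L `<=` M, M `<=` N
                           & ru_complete M]]) M.

Lemma leUvl x y : x <= vjoin x y.
Proof. by have := lexx (vjoin x y); rewrite leUv => /andP[]. Qed.

Lemma leUvr x y : y <= vjoin x y.
Proof. by have := lexx (vjoin x y); rewrite leUv => /andP[]. Qed.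

Lemma lev_add x y z w : x <= y -> z <= w -> x + z <= y + w.
Proof.
move=> xy zw; apply: le_trans (lev_addr z _ _ xy) _.
by rewrite ![y + _]addrC; exact: lev_addr.
Qed.

Lemma lev_opp x y : x <= y -> - y <= - x.
Proof.
by move=> /(lev_addr (- x - y)); rewrite addrA subrr add0r addrCA subrr addr0.
Qed.

Lemma vabs_ge0 x : 0 <= vabs x.
Proof.
have h : 0 <= vabs x + vabs x.
  by rewrite -(subrr x); apply: lev_add; [exact: leUvl|exact: leUvr].
have i2 : 0 <= 2^-1 :> R by rewrite invr_ge0.
have := scalev_ge0 _ _ i2 h.
by rewrite -mulr2n -(scaler_nat 2 (vabs x)) scalerA mulVf ?pnatr_eq0// scale1r.
Qed.

(* This identifies the Dedekind completion of the principal ideal L_x with the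
   principal ideal generated by x in the Dedekind completion V of L. *)
Lemma dedekind_completion_ideal L x :
  vector_sublattice L -> L x -> dedekind_completion L setT ->
  dedekind_completion (principal_ideal L x) (principal_ideal setT x).
Proof.
move=> [L0 Llin LU _] Lx [_ Dc Ld Lm]; split.
- by move=> y [_ ?]; split.
- move=> A AD [a0 Aa0] [b [_ [mu mu0 bmu]] Ab].
  have [|||s _ [sub slub]] := Dc A; [by []|by exists a0|by exists b|].
  exists s; last by split=> // c _; exact: slub.
  have [_ [la la0 a0la]] := AD _ Aa0; split=> //; exists (la + mu).
    exact: addr_ge0.
  rewrite scalerDl leUv; apply/andP; split.
    rewrite -[leLHS]add0r; apply: lev_add; first exact/scalev_ge0/vabs_ge0.
    by apply: le_trans (slub b _ Ab) (le_trans _ bmu) => //; exact: leUvl.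
  rewrite -[leLHS]addr0; apply: lev_add; last exact/scalev_ge0/vabs_ge0.
  by apply: le_trans (lev_opp (sub _ Aa0)) (le_trans _ a0la); exact: leUvr.
- move=> y [_ [a a0 ya]] y0; have [//|z Lz /andP[z0 zy]] := Ld y _ y0.
  exists z; last by rewrite z0.
  split=> //; exists a => //; apply: le_trans ya.
  apply: le_trans (leUvl _ _); rewrite leUv zy/=; apply: le_trans (ltW y0).
  by rewrite -oppr0; exact/lev_opp/ltW.
- have LN z : L z -> L (- z).
    by move=> Lz; rewrite -scaleN1r -[_ *: _]addr0; exact: Llin.
  move=> y [_ [a a0 ya]]; exists (a *: vabs x); last first.
    by apply: le_trans ya; exact: leUvl.
  split; first by rewrite -[_ *: _]addr0; apply: Llin => //; exact/LU/LN.
  exists a => //; rewrite leUv lexx/=; apply: (@le_trans _ _ 0).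
    by rewrite -oppr0; exact/lev_opp/scalev_ge0/vabs_ge0.
  exact/scalev_ge0/vabs_ge0.
Qed.

End vector_lattices.

(* The vector lattice of continuous functions X -> R, as a subtype of X -> R. *)
Section continuous_functions.
Context {X : topologicalType} {R : realType}.

Definition cts : {pred X -> R} := fun f => `[< continuous f >].

Let ctsP (f : X -> R) : f \in cts <-> continuous f.
Proof. by split=> [/asboolP|?]; last exact/asboolP. Qed.

Let Sub_cts (f : X -> R) (cf : f \in cts) : continuousType X R :=
  mkcts ((ctsP f).1 cf).

Let Sub_cts_rect (K : continuousType X R -> Type) :
  (forall f (cf : f \in cts), K (Sub_cts cf)) -> forall f, K f.
Proof.
move=> KS f.
have cf : (f : X -> R) \in cts by apply/ctsP; exact: cts_fun.
by have -> : f = Sub_cts cf; [exact/continuousEP|exact: KS].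
Qed.

HB.instance Definition _ := @isSub.Build (X -> R) cts (continuousType X R)
  (fun f => f) Sub_cts Sub_cts_rect (fun f _ => erefl).

Let cts_submod : GRing.subsemimod_closed cts.
Proof.
split; first split.
- by apply/ctsP => x; exact: cst_continuous.
- move=> f g /ctsP cf /ctsP cg; apply/ctsP => x.
  exact: (continuousD (cf x) (cg x)).
- move=> a f /ctsP cf; apply/ctsP => x.
  exact: (continuousZl_tmp (k := a) (cf x)).
Qed.

HB.instance Definition _ :=
  @GRing.SubChoice_isSubLmodule.Build R (X -> R) cts (continuousType X R)
    cts_submod.

HB.instance Definition _ := Order.SubChoice_isSubPOrder.Build
  FunOrder.fun_display (X -> R) cts ring_display (continuousType X R).

Lemma ctsleP (f g : continuousType X R) :
  reflect (forall x, f x <= g x) (f <= g).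
Proof. by rewrite leEsub; exact: lefP. Qed.

Let cts_max (f g : continuousType X R) : continuous (f \max g).
Proof. by move=> x; apply: continuous_max; exact: cts_fun. Qed.

Let cts_min (f g : continuousType X R) : continuous (f \min g).
Proof. by move=> x; apply: continuous_min; exact: cts_fun. Qed.

Let joinc (f g : continuousType X R) : continuousType X R :=
  mkcts (@cts_max f g).

Let meetc (f g : continuousType X R) : continuousType X R :=
  mkcts (@cts_min f g).

Let ctsle_addr (h f g : continuousType X R) : f <= g -> f + h <= g + h.
Proof.
move=> /ctsleP fg; apply/ctsleP => x.
change (f x + h x <= g x + h x).
by rewrite lerD2r.
Qed.

Let cts_scale_ge0 (a : R) (f : continuousType X R) :
  0 <= a -> 0 <= f -> 0 <= a *: f.
Proof. by move=> a0 /ctsleP f0; apply/ctsleP => x; exact: mulr_ge0 (f0 x). Qed.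

Let lecU (f g h : continuousType X R) :
  (joinc f g <= h) = (f <= h) && (g <= h).
Proof.
apply/ctsleP/andP => [fgh|[/ctsleP fh /ctsleP gh] x].
  split; apply/ctsleP => x; apply: le_trans (fgh x).
    by rewrite /= le_max lexx.
  by rewrite /= le_max lexx orbT.
by rewrite /= ge_max fh gh.
Qed.

Let lecI (f g h : continuousType X R) :
  (h <= meetc f g) = (h <= f) && (h <= g).
Proof.
apply/ctsleP/andP => [fgh|[/ctsleP fh /ctsleP gh] x].
  split; apply/ctsleP => x; apply: (le_trans (fgh x)).
    by rewrite /= ge_min lexx.
  by rewrite /= ge_min lexx orbT.
by rewrite /= le_min fh gh.
Qed.

HB.instance Definition _ :=
  @POrderedLmodule_isVectorLattice.Build R (continuousType X R)
    ctsle_addr cts_scale_ge0 joinc meetc lecU lecI.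

End continuous_functions.

Section unit_interval.
Context (R : realType).

Definition I01 : topologicalType := set_type `[0 : R, 1]%classic.

Definition C01 : vectorLatticeType R := continuousType I01 R.

Definition id01 : C01 := mkcts (@initial_continuous I01 R set_val).

(* 0 = t_0 < ... < t_n = 1 with t = 0 :: s, and f(t) = a t + b on each
   [t_i, t_(i+1)]. *)
Definition piecewise_linear (f : C01) : Prop :=
  exists s : seq R,
    [/\ path <%R 0 s, last 0 s = 1
      & forall i, (i < size s)%N -> exists a b : R, forall x : I01,
          nth 0 (0 :: s) i <= set_val x <= nth 0 s i ->
          (f : I01 -> R) x = a * set_val x + b].

Definition PL01 : set C01 := [set f | piecewise_linear f].

End unit_interval.

(* Main.v *)
Require Import Defs.
From HB Require Import structures.
From mathcomp Require Import all_boot all_order all_algebra.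
From mathcomp Require Import all_classical all_reals all_analysis.
From mathcomp Require Import ring lra.
Set Implicit Arguments.
Unset Strict Implicit.
Unset Printing Implicit Defensive.
Import Order.TTheory GRing.Theory Num.Theory.
Import numFieldNormedType.Exports.
Local Open Scope classical_set_scope.
Local Open Scope ring_scope.

(** Both relatively uniform completions are instances of one fact
    ([ru_completion_unif_closure]): if a sublattice P of C[0,1] has a strong
    unit w, its relatively uniform completion consists of the functions that
    are w-uniform limits of elements of P. Indeed a uniformly complete
    sublattice of the Dedekind completion D that contains P absorbs such
    limits, because D is Archimedean and so limits in it do not depend on the
    regulator ([ru_complete_closed]). Conversely the w-uniform closure is itself
    uniformly complete: a relatively uniformly Cauchy sequence of continuous
    functions has a pointwise limit, which satisfies the same estimates and is
    continuous ([cts_ru_limits]), and every regulator in the closure is bounded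
    by a multiple of w, so the limit stays in the closure.

    For the piecewise linear functions the constant 1 is a strong unit, and its
    uniform closure is all of C[0,1] ([PL01_dense]). For their ideal generated
    by u(t) = t, the function u is a strong unit, and the closure is the set in
    the theorem.

    That the piecewise linear functions form a sublattice is seen locally: f is
    piecewise linear iff it is affine on a small interval on either side of
    each point ([PL01_germs]), and such one-sided germs are stable under linear
    combinations and suprema because an affine function has constant sign just
    beside a point. The passage from local to global, here, in the density
    theorem and in the boundedness of continuous functions, is always the same
    induction over subintervals ([segment_induction]), which takes the place of
    compactness.

    The inclusion is strict because a piecewise linear function vanishing at 0
    is m t near 0, so the quotient by t of a u-uniform limit f of such functions
    converges at 0; but sin (1/t) oscillates, and t sin (1/t) is in the ideal
    generated by u. *)

(** * Vector lattices and uniform limits *)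

Section vector_lattice_theory.
Context {R : realType} {V : vectorLatticeType R}.
Implicit Types (x y z w : V) (a e : R) (L M N : set V).

Lemma vabs_le x y : (vabs x <= y) = (x <= y) && (- x <= y).
Proof. exact: leUv. Qed.

Lemma le_vabs x : x <= vabs x.
Proof. exact: leUvl. Qed.

Lemma leN_vabs x : - x <= vabs x.
Proof. exact: leUvr. Qed.

Lemma vabsN x : vabs (- x) = vabs x.
Proof.
have le_absN y : vabs (- y) <= vabs y.
  by rewrite vabs_le opprK le_vabs leN_vabs.
by apply/le_anti; rewrite le_absN -{1}[x]opprK le_absN.
Qed.

Lemma vabs_distC x y : vabs (x - y) = vabs (y - x).
Proof. by rewrite -vabsN opprB. Qed.

Lemma vabsD x y : vabs (x + y) <= vabs x + vabs y.
Proof.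
by rewrite vabs_le opprD !lev_add ?le_vabs ?leN_vabs.
Qed.

Lemma vabs_dist_trans y x z : vabs (x - z) <= vabs (x - y) + vabs (y - z).
Proof. by have := vabsD (x - y) (y - z); rewrite addrA subrK. Qed.

Lemma ge0_vabs x : 0 <= x -> vabs x = x.
Proof.
move=> x0; apply/le_anti; rewrite le_vabs vabs_le lexx/= andbT.
by apply: le_trans (x0); rewrite -oppr0 lev_opp.
Qed.

Lemma vabs_le0 x : vabs x <= 0 -> x = 0.
Proof.
rewrite vabs_le => /andP[x0 /lev_opp]; rewrite opprK oppr0 => x0'.
by apply/le_anti; rewrite x0.
Qed.

Lemma lev_subl_addr x y z : (x - y <= z) = (x <= z + y).
Proof.
apply/idP/idP => [/(lev_addr y)|/(lev_addr (- y))]; first by rewrite subrK.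
by rewrite addrK.
Qed.

Lemma lev_scale a x y : 0 <= a -> x <= y -> a *: x <= a *: y.
Proof.
move=> a0 /(lev_addr (- x)); rewrite subrr => /(scalev_ge0 _ _ a0).
by rewrite scalerBr => /(lev_addr (a *: x)); rewrite add0r subrK.
Qed.

Lemma lev_wscale a e x : 0 <= x -> a <= e -> a *: x <= e *: x.
Proof.
move=> x0; rewrite -subr_ge0 => /scalev_ge0/(_ x0).
by rewrite scalerBl => /(lev_addr (a *: x)); rewrite add0r subrK.
Qed.

Lemma vabs_scale a x : vabs (a *: x) <= `|a| *: vabs x.
Proof.
have pos b y : 0 <= b -> vabs (b *: y) <= b *: vabs y.
  by move=> b0; rewrite vabs_le -scalerN !lev_scale ?le_vabs ?leN_vabs.
have [a0|a0] := ger0P a; first exact: pos.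
by rewrite -vabsN -scaleNr pos// oppr_ge0 ltW.
Qed.

Lemma vabs_joinB x y z w :
  vabs (vjoin x y - vjoin z w) <= vabs (x - z) + vabs (y - w).
Proof.
have half x1 y1 z1 w1 :
    vjoin x1 y1 - vjoin z1 w1 <= vabs (x1 - z1) + vabs (y1 - w1).
  rewrite lev_subl_addr leUv; apply/andP; split.
    rewrite -[x1 in X in X <= _](subrK z1) lev_add ?leUvl//.
    by rewrite -[X in X <= _]addr0 lev_add ?le_vabs ?vabs_ge0.
  rewrite -[y1 in X in X <= _](subrK w1) lev_add ?leUvr//.
  by rewrite -[X in X <= _]add0r lev_add ?le_vabs ?vabs_ge0.
by rewrite vabs_le half opprB vabs_distC [vabs (y - w)]vabs_distC half.
Qed.

Lemma vmeetE x y : vmeet x y = - vjoin (- x) (- y).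
Proof.
have lIl : vmeet x y <= x by have := lexx (vmeet x y); rewrite levI => /andP[].
have lIr : vmeet x y <= y by have := lexx (vmeet x y); rewrite levI => /andP[].
apply/le_anti/andP; split.
  by rewrite -[X in X <= _]opprK lev_opp// leUv !lev_opp.
by rewrite levI -{2}[x]opprK -{3}[y]opprK !lev_opp ?leUvl ?leUvr.
Qed.

(** Stability under infima is automatic, by the duality between join and meet. *)
Lemma vector_sublatticeP L :
  L 0 -> (forall a x y, L x -> L y -> L (a *: x + y)) ->
  (forall x y, L x -> L y -> L (vjoin x y)) -> vector_sublattice L.
Proof.
move=> L0 Llin LU; split=> // x y Lx Ly.
have LN z : L z -> L (- z).
  by move=> Lz; rewrite -scaleN1r -[_ *: _]addr0; exact: Llin.
by rewrite vmeetE; apply/LN/LU; exact: LN.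
Qed.

Lemma principal_ideal_sublattice L x :
  vector_sublattice L -> vector_sublattice (principal_ideal L x).
Proof.
move=> [L0 Llin LU _]; apply: vector_sublatticeP.
- split=> //; exists 0 => //; rewrite scale0r ge0_vabs//.
- move=> a y z [Ly [l l0 yl]] [Lz [m m0 zm]]; split; first exact: Llin.
  exists (`|a| * l + m); first by rewrite addr_ge0 ?mulr_ge0.
  apply: le_trans (vabsD _ _) _; rewrite scalerDl lev_add// -scalerA.
  by apply: le_trans (vabs_scale _ _) _; exact: lev_scale.
- move=> y z [Ly [l l0 yl]] [Lz [m m0 zm]]; split; first exact: LU.
  exists (l + m); first exact: addr_ge0.
  have /le_trans -> // : vabs (vjoin y z) <= vabs y + vabs z.
    have := vabs_joinB y z 0 0; rewrite !subr0.
    suff -> : vjoin (0 : V) 0 = 0 by rewrite subr0.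
    by apply/le_anti; rewrite leUv lexx leUvl.
  by rewrite scalerDl lev_add.
Qed.

Definition archimedean_lattice : Prop :=
  forall x w, (forall e, 0 < e -> x <= e *: w) -> x <= 0.

(** If n x <= w for all n and s is the least upper bound of the multiples of x,
    then s - x is again an upper bound, so s <= s - x and x <= 0. *)
Lemma dedekind_archimedean :
  dedekind_complete [set: V] -> archimedean_lattice.
Proof.
move=> Dc x w xw; pose A := [set n.+1%:R *: x | n in [set: nat]].
have [|||s _ [sub slub]] := Dc A; [by []|by exists (1%:R *: x), 0%N| |].
  exists w => // _ [n _ <-].
  have n0 : 0 < n.+1%:R :> R by rewrite ltr0n.
  have := lev_scale (ltW n0) (xw n.+1%:R^-1 _).
  by rewrite invr_gt0 n0 scalerA divff ?gt_eqF// scale1r; exact.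
have : s <= s - x.
  apply: slub => // _ [n _ <-]; rewrite -[X in X <= _](addrK x) lev_addr//.
  by apply: sub; exists n.+1 => //; rewrite [in LHS]mulrSr scalerDl scale1r.
by move=> /(lev_addr (x - s)); rewrite addrCA subrr addr0 addrA subrK subrr.
Qed.

(** Approximating x within 1/(n+1) gives a Cauchy sequence in M. The limit that M
    supplies has its own regulator w', and w + w' is a common regulator for both
    limits; the Archimedean property identifies them. *)
Lemma ru_complete_closed M w x : archimedean_lattice -> ru_complete M ->
  M w -> 0 <= w ->
  (forall e, 0 < e -> exists2 y, M y & vabs (y - x) <= e *: w) -> M x.
Proof.
move=> arch Mc Mw w0 Mx.
have /choice[y_ yP] n : exists y, M y /\ vabs (y - x) <= (harmonic n : R) *: w.
  by have [|y My yx] := Mx (harmonic n); [exact: harmonic_gt0|exists y].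
have [n||x' Mx' [w' [eps [Mw' w'0 eps0 yx']]]] := Mc y_.
- by case: (yP n).
- exists w, (fun n => harmonic n + harmonic n); split=> //.
    by rewrite -[0 : R]addr0; apply: cvgD; exact: cvg_harmonic.
  move=> n m nm; apply: le_trans (vabs_dist_trans x _ _) _.
  rewrite scalerDl lev_add//; first by case: (yP n).
  rewrite vabs_distC; apply: le_trans (proj2 (yP m)) _.
  by apply: lev_wscale => //=; rewrite lef_pV2 ?posrE ?ltr0n// ler_nat ltnS.
suff /subr0_eq <- : x' - x = 0 by [].
apply/vabs_le0/(arch _ (w' + w)) => e e0.
have hcvg := @cvg_harmonic R.
have [n [en hn]] : exists n, eps n <= e /\ harmonic n <= e.
  near \oo => n; exists n; split.
    by near: n; apply: cvgr_le eps0 _ e0.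
  by near: n; apply: cvgr_le hcvg _ e0.
apply: le_trans (vabs_dist_trans (y_ n) _ _) _.
rewrite scalerDr vabs_distC lev_add//.
  by apply: le_trans (yx' n) _; exact: lev_wscale.
by apply: le_trans (proj2 (yP n)) _; exact: lev_wscale.
Unshelve. all: by end_near. Qed.

(** Approximation within every e is equivalent to being the limit of a sequence
    with regulator w, and avoids the choice of sequences in closure proofs. *)
Definition unif_closure L w : set V :=
  [set x | forall e, 0 < e -> exists2 y, L y & vabs (y - x) <= e *: w].

Lemma subset_unif_closure L w : 0 <= w -> L `<=` unif_closure L w.
Proof.
move=> w0 x Lx e /ltW e0; exists x => //.
by rewrite subrr ge0_vabs// scalev_ge0.
Qed.

Lemma unif_closure_sublattice L w : 0 <= w ->
  vector_sublattice L -> vector_sublattice (unif_closure L w).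
Proof.
move=> w0 [L0 Llin LU _]; apply: vector_sublatticeP.
- exact: subset_unif_closure.
- move=> a x y Lx Ly e e0.
  have a1 : 0 < `|a| + 1 by rewrite ltr_wpDl.
  have [|x' Lx' xx'] := Lx (e / 2 / (`|a| + 1)); first by rewrite !divr_gt0.
  have [|y' Ly' yy'] := Ly (e / 2); first by rewrite divr_gt0.
  exists (a *: x' + y'); first exact: Llin.
  rewrite opprD addrACA -scalerBr.
  apply: le_trans (vabsD _ _) _; rewrite [e in e *: w]splitr scalerDl.
  rewrite lev_add//; apply: le_trans (vabs_scale _ _) _.
  apply: le_trans (lev_scale _ xx') _ => //; rewrite scalerA lev_wscale//.
  rewrite mulrCA ler_piMr ?divr_ge0 ?ltW//.
  by rewrite ltr_pdivrMr// mul1r ltrDl.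
- move=> x y Lx Ly e e0.
  have [|x' Lx' xx'] := Lx (e / 2); first by rewrite divr_gt0.
  have [|y' Ly' yy'] := Ly (e / 2); first by rewrite divr_gt0.
  exists (vjoin x' y'); first exact: LU.
  apply: le_trans (vabs_joinB _ _ _ _) _.
  by rewrite [e in e *: w]splitr scalerDl lev_add.
Qed.

(** The limit satisfies the very estimates of the Cauchy condition, with the
    same regulator: this is what keeps the limit in a given uniform closure. *)
Definition has_ru_limits : Prop := forall (x_ : nat -> V) w (eps : nat -> R),
  0 <= w -> eps @ \oo --> (0 : R) ->
  (forall n m, (n <= m)%N -> vabs (x_ n - x_ m) <= eps n *: w) ->
  exists x, forall n, vabs (x_ n - x) <= eps n *: w.

End vector_lattice_theory.
Arguments archimedean_lattice {R} V.
Arguments has_ru_limits {R} V.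

(** * Completion of a sublattice with a strong unit *)

Section lattice_embedding.
Context {R : realType} {C D : vectorLatticeType R} (j : {linear C -> D}).
Context (j_inj : injective j).
Context (j_join : {morph j : f g / vjoin f g >-> vjoin f g}).
Implicit Types (f g w : C) (P : set C) (N : set D).

Lemma embedding_le f g : (j f <= j g) = (f <= g).
Proof.
have joinE (U : vectorLatticeType R) (x y : U) : (x <= y) = (vjoin x y == y).
  apply/idP/eqP => [xy|<-]; last exact: leUvl.
  by apply/le_anti; rewrite leUv xy lexx leUvr.
by rewrite !joinE -j_join (inj_eq j_inj).
Qed.

Lemma embedding_vabs f : vabs (j f) = j (vabs f).
Proof. by rewrite /vabs j_join linearN. Qed.

Lemma embedding_vabs_le f g a : (vabs (j f) <= a *: j g) = (vabs f <= a *: g).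
Proof. by rewrite embedding_vabs -linearZ embedding_le. Qed.

Lemma embedding_sublattice P :
  vector_sublattice P -> vector_sublattice (j @` P).
Proof.
move=> [P0 Plin PU _]; apply: vector_sublatticeP.
- by exists 0; rewrite ?linear0.
- move=> a _ _ [f Pf <-] [g Pg <-]; exists (a *: f + g); first exact: Plin.
  by rewrite linearP.
- move=> _ _ [f Pf <-] [g Pg <-]; exists (vjoin f g); first exact: PU.
  exact: j_join.
Qed.

Lemma embedding_principal_ideal P f :
  principal_ideal (j @` P) (j f) = j @` principal_ideal P f.
Proof.
apply/seteqP; split=> [_ [[g Pg <-] [a a0 ga]]|_ [g [Pg [a a0 ga]] <-]].
  exists g => //; split=> //; exists a => //.
  by rewrite -embedding_vabs_le -embedding_vabs.
split; first by exists g.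
by exists a => //; rewrite !embedding_vabs -linearZ embedding_le.
Qed.

(** A regulator v of the closure lies within w of an element of P, hence
    v <= a w for some a: relatively uniform convergence inside the closure is
    w-uniform convergence, for which the closure is closed. *)
Lemma unif_closure_ru_complete P w : has_ru_limits C -> 0 <= w ->
  (forall f, P f -> exists a, vabs f <= a *: w) ->
  ru_complete (j @` unif_closure P w).
Proof.
move=> Clim w0 Pw y_ /= y_P.
have /choice[f_ fP] n : exists f, unif_closure P w f /\ j f = y_ n.
  by have [f Pf fy] := y_P n; exists f.
move=> [_ [eps [[v Pv <-] v0 eps0 y_cauchy]]].
have v0' : 0 <= v by rewrite -embedding_le linear0.
have [|||f ff] := Clim f_ v eps => //.
  move=> n m nm; rewrite -embedding_vabs_le linearB/=.
  by rewrite !(proj2 (fP _)) y_cauchy.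
exists (j f); last first.
  exists (j v), eps; split=> //.
  move=> n; rewrite -(proj2 (fP n)) -linearB embedding_vabs_le; exact: ff.
exists f => // e e0.
(* an element g of P within w of v, and g <= a w *)
have [a va] : exists a, v <= a *: w.
  have [|g Pg gv] := Pv 1 => //; have [a ga] := Pw _ Pg.
  exists (1 + a); rewrite scalerDl -lev_subl_addr.
  apply: le_trans _ gv; rewrite vabs_distC.
  apply: le_trans _ (le_vabs _); apply: lev_add => //; apply: lev_opp.
  exact: le_trans (le_vabs _) ga.
have a1 : 0 < `|a| + 1 by rewrite ltr_wpDl.
have ea0 : 0 < e / 2 / (`|a| + 1) by rewrite !divr_gt0.
have [n en] : exists n, eps n <= e / 2 / (`|a| + 1).
  by near \oo => n; exists n; near: n; apply: cvgr_le eps0 _ ea0.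
have [|g Pg gf] := (proj1 (fP n)) (e / 2); first by rewrite divr_gt0.
exists g => //; apply: le_trans (vabs_dist_trans (f_ n) _ _) _.
rewrite [e in e *: w]splitr scalerDl lev_add//.
apply: le_trans (ff n) _; apply: le_trans (lev_wscale v0' en) _.
apply: le_trans (lev_scale (ltW ea0) va) _; rewrite scalerA lev_wscale//.
rewrite -mulrA ler_piMr ?divr_ge0 ?(ltW e0)// ler_pdivrMl// mulr1.
by rewrite (le_trans (ler_norm a))// lerDl.
Unshelve. all: by end_near. Qed.

Lemma ru_completion_unif_closure P w N :
  archimedean_lattice D -> has_ru_limits C ->
  vector_sublattice P -> P w -> 0 <= w ->
  (forall f, P f -> exists a, vabs f <= a *: w) ->
  j @` unif_closure P w `<=` N ->
  ru_completion (j @` P) N = j @` unif_closure P w.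
Proof.
move=> Darch Clim Psub Pw w0 Pbd PN; apply/seteqP; split=> [y|_ [f Pf <-] M].
  apply; split=> //.
  - exact/embedding_sublattice/unif_closure_sublattice.
  - by apply: image_subset; exact: subset_unif_closure.
  - exact: unif_closure_ru_complete.
move=> [_ PM _ Mc]; apply: (ru_complete_closed (w := j w)) => //.
- by apply: PM; exists w.
- by rewrite -[0 : D](linear0 j) embedding_le.
move=> e /Pf[g Pg gf]; exists (j g); first by apply: PM; exists g.
by rewrite -linearB embedding_vabs_le.
Qed.

End lattice_embedding.

(** * Relatively uniform limits of continuous functions *)

Section continuous_functions.
Context {X : topologicalType} {R : realType}.
Implicit Types (f g w : continuousType X R) (x : X).

Lemma ctsD f g x : (f + g) x = f x + g x. Proof. by []. Qed.
Lemma ctsN f x : (- f) x = - f x. Proof. by []. Qed.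
Lemma ctsZ (a : R) f x : (a *: f) x = a * f x. Proof. by []. Qed.
Lemma cts_joinE f g x : vjoin f g x = Num.max (f x) (g x). Proof. by []. Qed.
Lemma cts_absE f x : vabs f x = `|f x|.
Proof. by rewrite [LHS]cts_joinE ctsN maxrN. Qed.

Lemma cts_abs_leP f g : (forall x, `|f x| <= g x) <-> vabs f <= g.
Proof.
split=> [fg|/ctsleP fg x]; last by rewrite -cts_absE.
by apply/ctsleP => x; rewrite cts_absE.
Qed.

(** The regulator is continuous, hence bounded near each point: the convergence
    is locally uniform, and the pointwise limit is continuous. *)
Lemma cts_ru_limits : has_ru_limits (continuousType X R).
Proof.
move=> f_ w eps w0 eps0 f_cauchy.
have fnm n m x : (n <= m)%N -> `|f_ n x - f_ m x| <= eps n * w x.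
  by move=> /f_cauchy/cts_abs_leP/(_ x).
have epsw0 x : eps n * w x @[n --> \oo] --> (0 : R).
  by rewrite -[0 : R](mul0r (w x)); apply: cvgMr_tmp.
pose g x : R := lim (f_ n x @[n --> \oo]).
have gP x : f_ n x @[n --> \oo] --> g x.
  apply/cauchy_cvgP/cauchy_exP => e e0.
  have [n en] : exists n, eps n * w x < e.
    by near \oo => n; exists n; near: n; apply: cvgr_lt (epsw0 x) _ e0.
  exists (f_ n x), n => // m /= nm.
  by rewrite /ball/=; apply: le_lt_trans en; exact: fnm.
have fg n x : `|f_ n x - g x| <= eps n * w x.
  have dP : `|f_ n x - f_ m x| @[m --> \oo] --> `|f_ n x - g x|.
    by apply: cvg_norm; apply: cvgB (gP x); exact: cvg_cst.
  apply: (closed_cvg (fun y => y <= eps n * w x)) dP; first exact: closed_le.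
  by exists n => // m /= nm; exact: fnm.
have cg : continuous g.
  move=> x; apply/cvgrPdist_le => e e0.
  have e3 : 0 < e / 3 by rewrite divr_gt0.
  have w1 : 0 < w x + 1 by rewrite ltr_wpDl//; move/ctsleP : w0; exact.
  have [n en] : exists n, `|eps n| <= e / 3 / (w x + 1).
    near \oo => n; exists n; near: n; apply: cvgr0_norm_le => //.
    by rewrite divr_gt0.
  have small y : 0 <= w y -> w y <= w x + 1 -> `|f_ n y - g y| <= e / 3.
    move=> wy0 wy; apply: le_trans (fg n y) _.
    apply: (@le_trans _ _ (`|eps n| * w y)); first by rewrite ler_wpM2r ?ler_norm.
    apply: (@le_trans _ _ (e / 3 / (w x + 1) * (w x + 1))).
      by apply: ler_pM.
    by rewrite divfK// gt_eqF.
  have wge0 y : 0 <= w y by move/ctsleP : w0; exact.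
  near=> y.
  have wy : w y <= w x + 1.
    near: y; apply: (cvgr_le (w x)); first exact: cts_fun.
    by rewrite ltrDl.
  have fxy : `|f_ n x - f_ n y| <= e / 3.
    by near: y; apply: cvgr_dist_le => //; exact: cts_fun.
  have wx : w x <= w x + 1 by rewrite lerDl.
  have hx := small _ (wge0 x) wx; have hy := small _ (wge0 y) wy.
  move: hx hy fxy; rewrite !ler_norml; lra.
exists (mkcts cg : continuousType X R) => n; apply/cts_abs_leP => x; exact: fg.
Unshelve. all: by end_near. Qed.

End continuous_functions.

(** * From local to global on an interval *)

Section interval_induction.
Context {R : realType}.

(** A property of intervals that is inherited by concatenations and holds for
    all short intervals ending or starting at any given point holds for [a, b]:
    the supremum c of the x such that P a x holds is attained, thanks to the
    intervals ending at c, and equals b, thanks to those starting at c. *)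
Lemma segment_induction (P : R -> R -> Prop) (a b : R) : a < b ->
  (forall x y z, x < y -> y < z -> P x y -> P y z -> P x z) ->
  (forall x, a <= x < b -> exists2 d, 0 < d &
    forall y, x < y -> y <= x + d -> P x y) ->
  (forall x, a < x <= b -> exists2 d, 0 < d &
    forall y, x - d <= y -> y < x -> P y x) ->
  P a b.
Proof.
move=> ab Pcat Pr Pl.
pose S := [set x | a < x <= b /\ P a x].
have [d d0 Pd] : exists2 d, 0 < d & forall y, a < y -> y <= a + d -> P a y.
  by apply: Pr; rewrite lexx.
have Sub : ubound S b by move=> x [/andP[]].
have ubS : has_ubound S by exists b.
have Sd : S (Num.min b (a + d)).
  have ad : a < Num.min b (a + d) by rewrite lt_min ab ltrDl.
  split; first by rewrite ad ge_min lexx.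
  by apply: Pd => //; rewrite ge_min lexx orbT.
have supS : has_sup S by split; [exists (Num.min b (a + d))|exists b].
set c := sup S.
have ac : a < c.
  by case: (Sd) => /andP[h _] _; apply: lt_le_trans h _; exact: (ub_le_sup ubS).
have cb : c <= b by apply: ge_sup => //; exists (Num.min b (a + d)).
have Pac : P a c.
  have [|e e0 Pe] := Pl c; first by rewrite ac.
  have [x Sx xc] := sup_adherent e0 supS.
  have : x <= c by exact: (ub_le_sup ubS).
  have [/andP[ax _] Pax] := Sx.
  rewrite le_eqVlt => /orP[/eqP <- //|xc'].
  by apply: Pcat Pax _ => //; apply: Pe => //; exact: ltW.
have [->//|cb'] := eqVneq b c.
have {cb'} cb' : c < b by rewrite lt_neqAle eq_sym cb' cb.
have [|e e0 Pe] := Pr c; first by rewrite (ltW ac).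
have ce : c < Num.min b (c + e) by rewrite lt_min cb' ltrDl.
suff /(ub_le_sup ubS) : S (Num.min b (c + e)).
  by rewrite leNgt ce.
split; first by rewrite (lt_trans ac ce) ge_min lexx.
by apply: Pcat Pac _ => //; apply: Pe => //; rewrite ge_min lexx orbT.
Qed.

End interval_induction.

(** * Piecewise linear functions *)

Section unit_interval_theory.
Context {R : realType}.
Implicit Types (f g h : C01 R) (x y : I01 R) (a b c d e t : R).

Local Notation "f ' x" := ((f : C01 R) (x : I01 R) : R)
  (at level 10, x at level 9, only parsing).

Lemma I01_ge0 x : 0 <= set_val x.
Proof. by have := set_valP x; rewrite /= in_itv/= => /andP[]. Qed.

Lemma I01_le1 x : set_val x <= 1.
Proof. by have := set_valP x; rewrite /= in_itv/= => /andP[]. Qed.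

Lemma I01_surj t : 0 <= t <= 1 -> exists x, set_val x = t.
Proof.
move=> t01; have : t \in (`[0, 1]%classic : set R) by rewrite inE/= in_itv.
by move=> h; exists (SigSub h); rewrite set_valE.
Qed.

Lemma cts01_dist f x e : 0 < e -> exists2 d, 0 < d &
  forall y, `|set_val x - set_val y| <= d -> `|f ' x - f ' y| <= e.
Proof.
move=> e0; have /cvgr_dist_le/(_ _ e0) : f y @[y --> x] --> f x.
  exact: cts_fun.
rewrite nearE nbhsE => -[_ [[U Uo <-] Ux] Uf].
have /nbhs_ballP[d /= d0 dU] : nbhs (set_val x) U by exact: open_nbhs_nbhs.
exists (d / 2) => [|y xy]; first by rewrite divr_gt0.
apply: Uf; apply: dU; rewrite /ball/=; apply: le_lt_trans xy _.
by rewrite ltr_pdivrMr// ltr_pMr// ltr1n.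
Qed.

Definition one01 : C01 R := mkcts (@cst_continuous (I01 R) R 1).
Lemma one01E x : one01 ' x = 1. Proof. by []. Qed.

Definition affine01 a b : C01 R := a *: id01 R + b *: one01.

Lemma affine01E a b x : affine01 a b ' x = a * set_val x + b.
Proof. by rewrite -[b in RHS]mulr1. Qed.

(** The function equal to 0 up to a and to 1 from b on, and affine in between. *)
Definition ramp a b : C01 R :=
  vmeet (vjoin (affine01 (b - a)^-1 (- a / (b - a))) 0) one01.

Lemma rampE a b x :
  ramp a b ' x = Num.min (Num.max ((set_val x - a) / (b - a)) 0) 1.
Proof.
have -> : (set_val x - a) / (b - a) =
    affine01 (b - a)^-1 (- a / (b - a)) ' x.
  by rewrite affine01E mulrBl mulrC mulNr.
by [].
Qed.

Lemma ramp_ge0 a b x : 0 <= ramp a b ' x.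
Proof. by rewrite rampE le_min le_max lexx ler01 orbT. Qed.

Lemma ramp_le1 a b x : ramp a b ' x <= 1.
Proof. by rewrite rampE ge_min lexx orbT. Qed.

Lemma ramp_left a b x : a < b -> set_val x <= a -> ramp a b ' x = 0.
Proof.
move=> ab xa; rewrite rampE max_r ?min_l//.
by rewrite ler_pdivrMr ?subr_gt0// mul0r subr_le0.
Qed.

Lemma ramp_right a b x : a < b -> b <= set_val x -> ramp a b ' x = 1.
Proof.
move=> ab bx; rewrite rampE min_r// le_max ler_pdivlMr ?subr_gt0// mul1r.
by rewrite lerD2r bx.
Qed.

Definition affine_on f a b : Prop := exists p q, forall x,
  a <= set_val x <= b -> f ' x = p * set_val x + q.

Lemma affine_onS f a b c d : a <= c -> d <= b ->
  affine_on f a b -> affine_on f c d.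
Proof.
move=> ac db [p [q fE]]; exists p, q => x /andP[cx xd].
by apply: fE; rewrite (le_trans ac cx) (le_trans xd db).
Qed.

(** Subdivisions of an interval up to the choice of the list of nodes, in the
    form required by the induction over subintervals. *)
Inductive chain_affine f : R -> R -> Prop :=
| chain_affine1 a b : a < b -> affine_on f a b -> chain_affine f a b
| chain_affine_cat a b c :
    chain_affine f a b -> chain_affine f b c -> chain_affine f a c.

Definition affine_pieces f a (s : seq R) : Prop := path <%R a s /\
  forall i, (i < size s)%N -> affine_on f (nth 0 (a :: s) i) (nth 0 s i).

Lemma affine_pieces_chain f a s :
  s != [::] -> affine_pieces f a s -> chain_affine f a (last a s).
Proof.
elim: s a => // b s IH a _ [/= /andP[ab sb] fs].
have fab : chain_affine f a b by apply: chain_affine1 => //; exact: (fs 0%N).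
have [->//|s0] := eqVneq s [::].
apply: chain_affine_cat fab (IH _ s0 _); split=> // i si.
exact: (fs i.+1).
Qed.

Lemma chain_affine_pieces f a b : chain_affine f a b ->
  exists2 s, affine_pieces f a s & last a s = b.
Proof.
elim=> {a b} [a b ab fab|a b c _ [s1 [s1P fs1] <-] _ [s2 [s2P fs2] <-]].
  by exists [:: b] => //; split; [rewrite /= ab|case].
exists (s1 ++ s2); last by rewrite last_cat.
split=> [|i]; first by rewrite cat_path s1P.
rewrite size_cat nth_cat -cat_cons => si.
have [is1|s1i] := ltnP i (size s1).
  by rewrite nth_cat /= ltnS ltnW//; exact: fs1.
rewrite lastI cat_rcons nth_cat size_belast ltnNge s1i /=.
by apply: fs2; rewrite ltn_subLR.
Qed.

Lemma piecewise_linear_chain f : piecewise_linear f <-> chain_affine f 0 1.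
Proof.
split=> [[s [sP s1 fs]]|/chain_affine_pieces[s [sP fs] s1]]; last by exists s.
have <- : last 0 s = 1 by [].
apply: affine_pieces_chain => //.
by apply: contra_eq_neq s1 => ->; rewrite /= eq_sym oner_neq0.
Qed.

(** The parameter s is 1 for germs to the right of t, and -1 for germs to the left,
    so that both sides are treated at once; s (x - t) is the distance to t. *)
Definition affine_germ (s : R) f t : Prop := exists2 d, 0 < d &
  exists c m, forall x, 0 <= s * (set_val x - t) <= d ->
    f ' x = c + m * (s * (set_val x - t)).

Lemma affine_germ_right f t :
  affine_germ 1 f t <-> exists2 d, 0 < d & affine_on f t (t + d).
Proof.
split=> -[d d0]; last first.
  move=> [p [q fE]]; exists d => //; exists (p * t + q), p => x; rewrite mul1r.
  by move=> /andP[h1 h2]; rewrite fE; [ring|apply/andP; split; lra].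
move=> [c [m fE]]; exists d => //; exists m, (c - m * t) => x /andP[h1 h2].
by rewrite fE mul1r; [ring|apply/andP; split; lra].
Qed.

Lemma affine_germ_left f t :
  affine_germ (-1) f t <-> exists2 d, 0 < d & affine_on f (t - d) t.
Proof.
split=> -[d d0]; last first.
  move=> [p [q fE]]; exists d => //; exists (p * t + q), (- p) => x.
  by rewrite mulN1r => /andP[h1 h2]; rewrite fE; [ring|apply/andP; split; lra].
move=> [c [m fE]]; exists d => //; exists (- m), (c + m * t) => x /andP[h1 h2].
by rewrite fE mulN1r; [ring|apply/andP; split; lra].
Qed.

Definition has_affine_germs f a b : Prop :=
  (forall t, a <= t < b -> affine_germ 1 f t) /\
  (forall t, a < t <= b -> affine_germ (-1) f t).

Lemma chain_affine_germs f a b :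
  chain_affine f a b -> a < b /\ has_affine_germs f a b.
Proof.
elim=> {a b} [a b ab fab|a b c _ [ab [fr fl]] _ [bc [fr' fl']]].
  split=> //; split=> t /andP[h1 h2].
    apply/affine_germ_right; exists (b - t); first by rewrite subr_gt0.
    by rewrite addrC subrK; exact: affine_onS fab.
  apply/affine_germ_left; exists (t - a); first by rewrite subr_gt0.
  by rewrite subKr; exact: affine_onS fab.
split; [exact: lt_trans bc|split=> t /andP[at_ tc]].
  have [bt|tb] := leP b t; first by apply: fr'; rewrite bt.
  by apply: fr; rewrite at_.
have [tb|bt] := leP t b; first by apply: fl; rewrite at_.
by apply: fl'; rewrite bt.
Qed.

Lemma germs_chain_affine f a b :
  a < b -> has_affine_germs f a b -> chain_affine f a b.
Proof.
move=> ab [fr fl]; apply: segment_induction ab _ _ _ => [x y z _ _||].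
- exact: chain_affine_cat.
- move=> t /fr/affine_germ_right[d d0 fd]; exists d => // y ty yd.
  by apply: chain_affine1 => //; exact: affine_onS fd.
- move=> t /fl/affine_germ_left[d d0 fd]; exists d => // y ty yd.
  by apply: chain_affine1 => //; exact: affine_onS fd.
Qed.

Lemma PL01_germs f : PL01 f <-> has_affine_germs f 0 1.
Proof.
split=> [/piecewise_linear_chain/chain_affine_germs[]//|fg].
exact/piecewise_linear_chain/germs_chain_affine.
Qed.

(** By the sign of c or, if c = 0, by that of m. *)
Lemma affine_eventual_sign c m : exists2 d, 0 < d &
  (forall v, 0 <= v <= d -> 0 <= c + m * v) \/
  (forall v, 0 <= v <= d -> c + m * v <= 0).
Proof.
have pos c' m' : 0 < c' ->
    exists2 d, 0 < d & forall v, 0 <= v <= d -> 0 <= c' + m' * v.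
  move=> c0; have m1 : 0 < `|m'| + 1 by rewrite ltr_wpDl.
  exists (c' / (`|m'| + 1)) => [|v /andP[v0]]; first by rewrite divr_gt0.
  rewrite ler_pdivlMr// => vc.
  by have := ler_norm (- m'); rewrite normrN; nra.
have [c0|c0|->] := ltgtP c 0.
- have [|d d0 hd] := pos (- c) (- m); first by lra.
  by exists d => //; right=> v /hd; lra.
- by have [d d0 hd] := pos c m c0; exists d => //; left.
- exists 1 => //; have [m0|m0] := leP 0 m; [left|right] => v /andP[v0 _].
    by rewrite add0r mulr_ge0.
  by rewrite add0r mulr_le0_ge0// ltW.
Qed.

Lemma affine_germ_lin s a f g t :
  affine_germ s f t -> affine_germ s g t -> affine_germ s (a *: f + g) t.
Proof.
move=> [d d0 [c [m fE]]] [d' d'0 [c' [m' gE]]].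
exists (Num.min d d'); first by rewrite lt_min d0.
exists (a * c + c'), (a * m + m') => x; rewrite le_min => /and3P[h1 h2 h3].
rewrite [LHS]ctsD ctsZ fE ?h1// gE ?h1//; ring.
Qed.

(** Close enough to t, the difference of the two affine germs has a constant
    sign, and the join is one of them. *)
Lemma affine_germ_join s f g t :
  affine_germ s f t -> affine_germ s g t -> affine_germ s (vjoin f g) t.
Proof.
move=> [d d0 [c [m fE]]] [d' d'0 [c' [m' gE]]].
have [e e0 sgn] := affine_eventual_sign (c - c') (m - m').
exists (Num.min e (Num.min d d')); first by rewrite !lt_min e0 d0.
have {sgn}[sgn|sgn] := sgn; [exists c, m|exists c', m'] => x.
  rewrite !le_min => /and4P[h1 h2 h3 h4].
  have := sgn (s * (set_val x - t)); rewrite h1 h2 => /(_ isT) h.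
  rewrite [LHS]cts_joinE fE ?h1// gE ?h1// max_l//; lra.
rewrite !le_min => /and4P[h1 h2 h3 h4].
have := sgn (s * (set_val x - t)); rewrite h1 h2 => /(_ isT) h.
rewrite [LHS]cts_joinE fE ?h1// gE ?h1// max_r//; lra.
Qed.

Lemma PL01_affine a b : PL01 (affine01 a b).
Proof.
exists [:: 1]; split=> //=; first by rewrite ltr01.
by case=> // _; exists a, b => x _; exact: affine01E.
Qed.

Lemma PL01_sublattice : vector_sublattice (@PL01 R).
Proof.
apply: vector_sublatticeP.
- by have := PL01_affine 0 0; rewrite /affine01 !scale0r addr0.
- move=> a f g /PL01_germs[fr fl] /PL01_germs[gr gl]; apply/PL01_germs.
  split=> t t01; apply: affine_germ_lin.
  + exact: fr.
  + exact: gr.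
  + exact: fl.
  + exact: gl.
- move=> f g /PL01_germs[fr fl] /PL01_germs[gr gl]; apply/PL01_germs.
  split=> t t01; apply: affine_germ_join.
  + exact: fr.
  + exact: gr.
  + exact: fl.
  + exact: gl.
Qed.

Lemma PL01_id : PL01 (id01 R).
Proof.
by have := PL01_affine 1 0; rewrite /affine01 scale0r scale1r addr0.
Qed.

Lemma PL01_one : PL01 one01.
Proof.
by have := PL01_affine 0 1; rewrite /affine01 scale0r scale1r add0r.
Qed.

Lemma PL01_ramp a b : PL01 (ramp a b).
Proof.
have [P0 _ PU PI] := PL01_sublattice.
by apply: PI PL01_one; apply: PU P0; exact: PL01_affine.
Qed.

(** On the interval [a, b], phi follows the increments of f within e; it is
    constant outside, so that adding the functions for two consecutive intervals
    yields one for their union. The boundary conditions hold exactly, so that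
    errors do not add up. *)
Definition pl_increment f e a b : Prop := forall xa xb,
  set_val xa = a -> set_val xb = b -> exists2 phi, PL01 phi &
  [/\ forall x, set_val x <= a -> phi ' x = 0,
      forall x, b <= set_val x -> phi ' x = f ' xb - f ' xa
    & forall x, a <= set_val x <= b ->
        `|phi ' x - (f ' x - f ' xa)| <= e].

Lemma pl_increment_cat f e a b c : 0 <= a -> a < b -> b < c ->
  pl_increment f e a b -> pl_increment f e b c -> pl_increment f e a c.
Proof.
move=> a0 ab bc fab fbc xa xc xaE xcE.
have [|xb xbE] := @I01_surj b.
  by rewrite (le_trans a0 (ltW ab))/= (le_trans (ltW bc))// -xcE I01_le1.
have [phi Pphi [phi_l phi_r phi_m]] := fab _ _ xaE xbE.
have [psi Ppsi [psi_l psi_r psi_m]] := fbc _ _ xbE xcE.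
have [_ Plin _ _] := PL01_sublattice.
exists (phi + psi).
  by rewrite -[phi]scale1r; exact: Plin.
split=> x => [xa'|cx|/andP[ax xc']]; rewrite ctsD.
- by rewrite phi_l// psi_l ?addr0// (le_trans xa')// ltW.
- rewrite phi_r ?psi_r//; first by rewrite addrC subrKA.
  exact: le_trans (ltW bc) cx.
- have [xb'|bx] := leP (set_val x) b.
    by rewrite psi_l// addr0 phi_m// ax.
  rewrite phi_r; last exact: ltW.
  have := psi_m x; rewrite (ltW bx) xc' => /(_ isT).
  by rewrite !ler_norml; lra.
Qed.

(** A multiple of a ramp: its values are convex combinations of 0 and of
    f b - f a. *)
Lemma pl_increment_close f e a b : a < b ->
  (exists c, forall x, a <= set_val x <= b -> `|c - f ' x| <= e / 2) ->
  pl_increment f e a b.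
Proof.
move=> ab [c fc] xa xb xaE xbE.
have [P0 Plin _ _] := PL01_sublattice.
exists ((f ' xb - f ' xa) *: ramp a b).
  by rewrite -[_ *: _]addr0; apply: Plin => //; exact: PL01_ramp.
split=> x => [xa'|bx|xab]; rewrite ctsZ.
- by rewrite ramp_left ?mulr0.
- by rewrite ramp_right ?mulr1.
- have fx := fc _ xab; have := fc xa; rewrite xaE lexx ltW// => /(_ isT) fa.
  have := fc xb; rewrite xbE lexx ltW// => /(_ isT) fb.
  move: (ramp a b ' x) (ramp_ge0 a b x) (ramp_le1 a b x) => r r0 r1.
  move: fx fa fb; rewrite !ler_norml => /andP[? ?] /andP[? ?] /andP[? ?].
  by apply/andP; split; nra.
Qed.

(** By continuity, f varies by at most e on all short intervals at a given point,
    where a ramp suffices; the ramps add up along a subdivision. *)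
Lemma PL01_dense f e : 0 < e ->
  exists2 phi, PL01 phi & forall x, `|phi ' x - f ' x| <= e.
Proof.
move=> e0; have e2 : 0 < e / 2 by rewrite divr_gt0.
have near_close t : 0 <= t <= 1 -> exists2 d, 0 < d & exists c, forall x,
    t - d <= set_val x <= t + d -> `|c - f ' x| <= e / 2.
  move=> /I01_surj[xt xtE]; have [d d0 fd] := cts01_dist f xt e2.
  exists d => //; exists (f ' xt) => x /andP[h1 h2]; apply: fd.
  by rewrite xtE ler_distl; apply/andP; split; lra.
have : 0 <= (0 : R) /\ pl_increment f e 0 1.
  (* 0 <= a ensures that the nodes of the subdivision are points of [0, 1] *)
  pose P a b : Prop := 0 <= a -> pl_increment f e a b.
  split=> //; suff : P 0 1 by exact.
  apply: (@segment_induction _ P) => // [a b c ab bc Pab Pbc a0|t|t].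
  - apply: (pl_increment_cat a0 ab bc (Pab a0) (Pbc _)).
    exact: le_trans a0 (ltW ab).
  - move=> /andP[t0 /ltW t1]; have [|d d0 [c fc]] := near_close t.
      by rewrite t0.
    exists d => // y ty yd _; apply: pl_increment_close => //.
    by exists c => x /andP[h1 h2]; apply: fc; apply/andP; split; lra.
  - move=> /andP[/ltW t0 t1]; have [|d d0 [c fc]] := near_close t.
      by rewrite t0.
    exists d => // y ty yd _; apply: pl_increment_close => //.
    by exists c => x /andP[h1 h2]; apply: fc; apply/andP; split; lra.
have [|x0 x0E] := @I01_surj 0; first by rewrite lexx ler01.
have [|x1 x1E] := @I01_surj 1; first by rewrite lexx ler01.
move=> [_ /(_ _ _ x0E x1E)[phi Pphi [_ _ phif]]].
have [_ Plin _ _] := PL01_sublattice.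
exists (f ' x0 *: one01 + phi); first exact: Plin PL01_one Pphi.
move=> x; have := phif x; rewrite I01_ge0 I01_le1 => /(_ isT).
by rewrite ctsD ctsZ one01E mulr1 !ler_norml; lra.
Qed.

Lemma cts01_bounded f : exists M, forall x, `|f ' x| <= M.
Proof.
have : exists M, forall x, 0 <= set_val x <= 1 -> `|f ' x| <= M.
  pose P a b := exists M, forall x, a <= set_val x <= b -> `|f ' x| <= M.
  have near_bdd t : 0 <= t <= 1 -> exists2 d, 0 < d & P (t - d) (t + d).
    move=> /I01_surj[xt xtE]; have [d d0 fd] := cts01_dist f xt ltr01.
    exists d => //; exists (`|f ' xt| + 1) => x /andP[h1 h2].
    have /fd : `|set_val xt - set_val x| <= d.
      by rewrite xtE ler_distl; apply/andP; split; lra.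
    by rewrite distrC -lerBlDl; apply: le_trans; exact: lerB_dist.
  apply: (@segment_induction _ P) => // [a b c ab bc [M fM] [N fN]|t|t].
  - exists (Num.max M N) => x /andP[ax xc]; rewrite le_max.
    have [xb|bx] := leP (set_val x) b; first by rewrite fM ?ax.
    by rewrite fN ?orbT// (ltW bx).
  - move=> /andP[t0 /ltW t1]; have [|d d0 [M fM]] := near_bdd t.
      by rewrite t0.
    exists d => // y ty yd.
    by exists M => x /andP[h1 h2]; apply: fM; apply/andP; split; lra.
  - move=> /andP[/ltW t0 t1]; have [|d d0 [M fM]] := near_bdd t.
      by rewrite t0.
    exists d => // y ty yd.
    by exists M => x /andP[h1 h2]; apply: fM; apply/andP; split; lra.
by move=> [M fM]; exists M => x; apply: fM; rewrite I01_ge0 I01_le1.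
Qed.

End unit_interval_theory.

(** * An oscillating function *)

Section oscillation.
Context {R : realType}.

Let osc_fun (t : R) : R := t * sin t^-1.

Let osc_fun_continuous : continuous osc_fun.
Proof.
move=> t; have [->|t0] := eqVneq t 0.
  apply/cvgrPdist_le => e e0; rewrite /osc_fun mul0r; near=> s.
  rewrite sub0r normrN normrM; apply: (@le_trans _ _ `|s|).
    by rewrite ler_piMr// sin_max.
  by near: s; apply: (@cvgr0_norm_le _ _ _ _ _ id).
apply: cvgM; first exact: cvg_id.
by apply: cvg_comp; [exact: inv_continuous|exact: continuous_sin].
Unshelve. all: by end_near. Qed.

(** The function t sin (1/t), which vanishes at 0 since 0^-1 = 0. *)
Definition osc01 : C01 R :=
  mkcts (fun x => continuous_comp (@initial_continuous (I01 R) R set_val x)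
                    (@osc_fun_continuous (set_val x))).

Lemma osc01E (x : I01 R) :
  (osc01 : I01 R -> R) x = set_val x * sin (set_val x)^-1.
Proof. by []. Qed.

Lemma id01_ge0 : 0 <= id01 R.
Proof. by apply/ctsleP => x; exact: I01_ge0. Qed.

Lemma osc01_principal_ideal : principal_ideal [set: C01 R] (id01 R) osc01.
Proof.
split=> //; exists 1 => //; rewrite scale1r (ge0_vabs id01_ge0).
apply/cts_abs_leP => x; rewrite osc01E normrM ger0_norm ?I01_ge0//.
by rewrite ler_piMr ?I01_ge0// sin_max.
Qed.

(** By periodicity, take t = (a + 2 n pi)^-1 for a large n. *)
Lemma sin_inv_near0 (a d : R) : 0 <= a -> 0 < d ->
  exists2 t, 0 < t <= d & sin t^-1 = sin a.
Proof.
move=> a0 d0; pose n := (Num.truncn d^-1).+1.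
have nd : d^-1 < n%:R by exact: truncnS_gt.
have T : d^-1 < a + pi *+ 2 *+ n.
  apply: (lt_le_trans nd); rewrite -[X in X <= _]add0r lerD// -(mulr_natr (pi *+ 2)).
  rewrite ler_peMl// mulr2n; have := pi_ge2 R; lra.
have T0 : 0 < a + pi *+ 2 *+ n by apply: lt_trans T; rewrite invr_gt0.
exists (a + pi *+ 2 *+ n)^-1; last first.
  by rewrite invrK periodicn//; exact: sinD2pi.
by rewrite invr_gt0 T0 -[d]invrK lef_pV2 ?posrE ?invr_gt0// ltW.
Qed.

(** An approximation phi within u/4 is m t near 0, hence m is within 1/4 of all
    the values of the sine, in particular of 0 and of 1. *)
Lemma osc01_not_unif_closure :
  ~ unif_closure (principal_ideal (@PL01 R) (id01 R)) (id01 R) osc01.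
Proof.
move=> /(_ (1 / 4))[|phi [/PL01_germs[/(_ 0) phi0 _] [a a0 phia]]].
  by rewrite divr_gt0.
move=> /cts_abs_leP phi_osc.
have [|d d0 [c [m phiE]]] := phi0; first by rewrite lexx ltr01.
have c0 : c = 0.
  have [|x xE] := @I01_surj R 0; first by rewrite lexx ler01.
  have := phiE x; rewrite xE subrr mulr0 lexx ltW// => /(_ isT).
  move: phia; rewrite (ge0_vabs id01_ge0) => /cts_abs_leP/(_ x).
  rewrite ctsZ [X in _ <= _ * X]xE mulr0 mulr0 addr0 normr_le0.
  by move=> /eqP -> <-.
have slope (b : R) : 0 <= b -> `|m - sin b| <= 1 / 4.
  move=> b0; have [|t /andP[t0]] := @sin_inv_near0 b (Num.min d 1) b0.
    by rewrite lt_min d0 ltr01.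
  rewrite le_min => /andP[td t1] <-.
  have t0' := ltW t0; have [|x xE] := @I01_surj R t; first by rewrite t0'.
  have := phiE x; rewrite xE subr0 mul1r t0' td c0 add0r => /(_ isT) phix.
  have := phi_osc x; rewrite ctsD ctsN osc01E phix xE ctsZ.
  rewrite mulrC -mulrBr normrM gtr0_norm//.
  by rewrite [X in _ <= _ * X]xE [leRHS]mulrC ler_pM2l.
have := slope 0 (lexx 0); have := slope (pi / 2) (divr_ge0 (pi_ge0 R) (ler0n _ 2)).
rewrite sin_pihalf sin0 !ler_norml; lra.
Qed.

End oscillation.

(** * The theorem *)

(* D is the Dedekind completion of E = PL01 along j, and j is the embedding of
   C[0,1] into it. *)
Theorem mainTheorem1 (R : realType) (D : vectorLatticeType R)
    (j : {linear C01 R -> D})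
    (j_inj : injective j)
    (j_join : {morph j : f g / vjoin f g >-> vjoin f g})
    (j_meet : {morph j : f g / vmeet f g >-> vmeet f g})
    (D_completion : dedekind_completion (j @` @PL01 R) [set: D]) :
  let u : C01 R := id01 R in
  let E : set D := j @` @PL01 R in
  let E_u : set D := principal_ideal E (j u) in
  let E_ru : set D := ru_completion E [set: D] in
  let E_u_ru : set D := ru_completion E_u (principal_ideal [set: D] (j u)) in
  [/\ E_ru = j @` [set: C01 R],
      principal_ideal E_ru (j u) = j @` principal_ideal [set: C01 R] u,
      E_u_ru = j @` [set f : C01 R | exists (phi : nat -> C01 R) (eps : nat -> R),
        [/\ forall n, principal_ideal (@PL01 R) u (phi n),
            forall n, 0 < eps n,
            eps @ \oo --> (0 : R)
          & forall n, vabs (phi n - f) <= eps n *: u]]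
    & E_u_ru `<` principal_ideal E_ru (j u)].
Proof.
move=> u E E_u E_ru E_u_ru.
have arch : archimedean_lattice D.
  by case: D_completion => _ /dedekind_archimedean.
have u0 : 0 <= u := id01_ge0.
have PLu_sub := principal_ideal_sublattice u (@PL01_sublattice R).
have idealE := embedding_principal_ideal j_inj j_join.
have E_ruE : E_ru = j @` [set: C01 R].
  rewrite /E_ru (ru_completion_unif_closure (w := one01) j_inj j_join) //.
  - congr (_ @` _); apply/seteqP; split=> // f _ e /(PL01_dense f)[phi Pphi].
    move=> phif; exists phi => //; apply/cts_abs_leP => x.
    by rewrite ctsD ctsN ctsZ one01E mulr1.
  - exact: cts_ru_limits.
  - exact: PL01_sublattice.
  - exact: PL01_one.
  - by apply/ctsleP => x; exact: ler01.
  - move=> f _; have [M fM] := cts01_bounded f; exists M.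
    by apply/cts_abs_leP => x; rewrite ctsZ one01E mulr1.
pose G : set (C01 R) := unif_closure (principal_ideal (@PL01 R) u) u.
have G_ideal : G `<=` principal_ideal [set: C01 R] u.
  move=> f /(_ 1 ltr01)[phi [_ [a a0 phia]] phif]; split=> //.
  exists (1 + a); first by rewrite addr_ge0.
  rewrite -[f](subrK phi); apply: le_trans (vabsD _ _) _.
  by rewrite scalerDl lev_add// vabs_distC (ge0_vabs u0).
have E_u_ruE : E_u_ru = j @` G.
  rewrite /E_u_ru /E_u /E idealE.
  apply: (ru_completion_unif_closure j_inj j_join) => //.
  - exact: cts_ru_limits.
  - by split; [exact: PL01_id|exists 1 => //; rewrite scale1r].
  - by move=> f [_ [a _ fa]]; exists a; rewrite -(ge0_vabs u0).
  - move=> _ [f /G_ideal fu <-].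
    have : (j @` principal_ideal [set: C01 R] u) (j f) by exists f.
    by rewrite -idealE => -[].
have ideal_ruE : principal_ideal E_ru (j u) =
    j @` principal_ideal [set: C01 R] u by rewrite E_ruE idealE.
split=> //.
- rewrite E_u_ruE; congr (_ @` _); apply/seteqP; split=> f.
    move=> fG.
    have /choice[phi phiP] n : exists g, principal_ideal (@PL01 R) u g /\
        vabs (g - f) <= (harmonic n : R) *: u.
      by have [g ? ?] := fG _ (@harmonic_gt0 R n); exists g.
    exists phi, harmonic; split=> [n|n||n].
    + by case: (phiP n).
    + exact: harmonic_gt0.
    + exact: cvg_harmonic.
    + by case: (phiP n).
  move=> [phi [eps [Pphi eps_gt0 eps0 phif]]] e e0.
  have [n en] : exists n, eps n <= e.
    by near \oo => n; exists n; near: n; apply: cvgr_le eps0 _ e0.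
  by exists (phi n) => //; apply: le_trans (phif n) _; exact: lev_wscale.
- rewrite E_u_ruE ideal_ruE; split; first exact: image_subset.
  move=> /(_ (j osc01)) sub.
  have [|f fG /j_inj fE] := sub.
    by exists osc01 => //; exact: osc01_principal_ideal.
  by apply: (@osc01_not_unif_closure R); rewrite -fE.
Unshelve. all: by end_near. Qed.
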